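(* For $k_1,\dots,k_r,n\in\mathbb{N}=\{1,2,\dots\}$ the function $\xi_{k_1,\dots,k_r}(n)$ is given by $$\xi_{k_1,\dots,k_r}(n)=\sum_{h=1}^{n-1}\ \sum_{1\le \ell_1<\ell_2<\dots<\ell_{h-1}<n-1}\ \sum_{\mathbf{f}\in\operatorname{stuffle}(\boldsymbol{\ell}_n^{[1]},\mathbf{k})}\zeta(k_1+1,\mathbf{f})$$ $$\qquad+\sum_{h=1}^{n-1}\ \sum_{1\le \ell_1<\ell_2<\dots<\ell_{h-1}<n-1}\ \sum_{\mathbf{f}\in\operatorname{stuffle}(\boldsymbol{\ell}_n^{[2]},\mathbf{k})}\zeta(k_1+1+\ell_1,\mathbf{f}),$$ with respect to the notation $\boldsymbol{\ell}_n^{[1]}=(\ell_1,\ell_2-\ell_1,\dots,n-\ell_{h-1}-1)$, $\boldsymbol{\ell}_n^{[2]}=(\ell_2,\ell_3-\ell_2,\dots,n-\ell_{h-1}-1)$, and $\mathbf{k}=(k_2,\dots,k_r)$.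
   Context: The multiple polylogarithm is $\operatorname{Li}_{k_1,\dots,k_r}(z)=\sum_{n_1>n_2>\dots>n_r\ge 1}\frac{z^{n_1}}{n_1^{k_1}n_2^{k_2}\cdots n_r^{k_r}}$, for positive integers $k_1,\dots,k_r$ (with $|z|\le 1$ if $k_1\ge 2$, and $|z|<1$ if $k_1=1$). The Arakawa–Kaneko function is $$\xi_{k_1,\dots,k_r}(s)=\frac{1}{\Gamma(s)}\int_0^\infty \frac{t^{s-1}}{e^t-1}\operatorname{Li}_{k_1,\dots,k_r}(1-e^{-t})\,dt,\qquad \Re(s)>0.$$ The multiple zeta function (multiple zeta value) is $\zeta(a_1,\dots,a_m)=\sum_{n_1>n_2>\dots>n_m\ge 1}\frac{1}{n_1^{a_1}\cdots n_m^{a_m}}$ for positive integers $a_i$ with $a_1\ge 2$. For a tuple $\mathbf{f}=(f_1,\dots,f_j)$, $\zeta(a,\mathbf{f})$ means $\zeta(a,f_1,\dots,f_j)$, and it means $\zeta(a)$ if $\mathbf{f}$ is empty. In the sums, the term $h=1$ is a single term, interpreted with $\ell_1=n-1$, $\boldsymbol{\ell}_n^{[1]}=(n-1)$ and $\boldsymbol{\ell}_n^{[2]}$ the empty tuple. Stuffle set: for strings $\mathbf{p}=(p_1,\dots,p_u)$ and $\mathbf{q}=(q_1,\dots,q_v)$, $\operatorname{stuffle}(\mathbf{p},\mathbf{q})$ is the smallest set of strings over the alphabet $\{p_1,\dots,p_u,q_1,\dots,q_v,\text{``}+\text{''},\text{``},\text{''},\text{``}(\text{''},\text{``})\text{''}\}$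 such that $(p_1,\dots,p_u,q_1,\dots,q_v)\in\operatorname{stuffle}(\mathbf{p},\mathbf{q})$ and, whenever a string of the form $(U,p_i,q_j,V)$ belongs to $\operatorname{stuffle}(\mathbf{p},\mathbf{q})$, so do $(U,q_j,p_i,V)$ and $(U,p_i+q_j,V)$. The $p_i,q_j$ are treated as formal symbols, so different formal strings giving the same integer tuple are counted separately. If one of the two strings is empty, the stuffle set consists of the other string only.
   Formalization: The second tuple is taken as (ℓ_2−ℓ_1, ℓ_3−ℓ_2, …, n−ℓ_{h−1}−1), since with first entry ℓ_2 the identity fails for n≥4 (e.g. k=(1), n=4); and n≥2 is assumed, since for n=1 the right side is an empty sum 0 while ξ(1)=ζ(k_1+1,k_2,…,k_r)>0. *)

(* Defs.v *)
From HB Require Import structures.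
From mathcomp Require Import all_boot all_order all_algebra.
From mathcomp Require Import all_classical all_reals all_analysis.
Set Implicit Arguments.
Unset Strict Implicit.
Unset Printing Implicit Defensive.
Import Order.TTheory GRing.Theory Num.Theory.
Import numFieldNormedType.Exports.
Local Open Scope classical_set_scope.
Local Open Scope ring_scope.

(* The sum over N > n_1 > ... > n_m >= 1 of 1 / (n_1 ^ a_1 ... n_m ^ a_m),
   written as an iterated sum with n_1 outermost; it is 1 for the empty tuple. *)
Fixpoint mhs (R : realType) (a : seq nat) (N : nat) : R :=
  if a is a1 :: a' then \sum_(1 <= m < N) (m%:R ^+ a1)^-1 * mhs R a' m else 1.

(* A nonempty tuple (a_1, ..., a_m) is passed as its head a_1 and its tail.
   [limn] is meaningful for a1 >= 2. *)
Definition mzv (R : realType) (a1 : nat) (a : seq nat) : R :=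
  limn (fun N : nat => \sum_(1 <= m < N) (m%:R ^+ a1)^-1 * mhs R a m).

Definition Li (R : realType) (k1 : nat) (k : seq nat) (z : R) : R :=
  limn (fun N : nat => \sum_(1 <= m < N) z ^+ m / m%:R ^+ k1 * mhs R k m).

Definition Gamma (R : realType) (s : R) : R :=
  \int[@lebesgue_measure R]_(t in `]0, +oo[) (t `^ (s - 1) * expR (- t)).

(* Only real arguments s > 0 are considered. *)
Definition xi (R : realType) (k1 : nat) (k : seq nat) (s : R) : R :=
  (Gamma s)^-1 *
  \int[@lebesgue_measure R]_(t in `]0, +oo[)
     (t `^ (s - 1) / (expR t - 1) * Li k1 k (1 - expR (- t))).

(* The entries of the formal strings: p_i, q_j and p_i + q_j, designated by
   their positions (counted from 0), so that strings which happen to have the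
   same integer value remain distinct. *)
Inductive letter : Type :=
  | Lp of nat
  | Lq of nat
  | Lpq of nat & nat.

HB.instance Definition _ := gen_eqMixin letter.
HB.instance Definition _ := gen_choiceMixin letter.

(* The stuffle set for strings p and q of lengths u and v, respectively. *)
Inductive is_stuffle (u v : nat) : seq letter -> Prop :=
  | stuffle_cat :
      is_stuffle u v ([seq Lp i | i <- iota 0 u] ++ [seq Lq j | j <- iota 0 v])
  | stuffle_swap (U V : seq letter) (i j : nat) :
      is_stuffle u v (U ++ [:: Lp i, Lq j & V]) ->
      is_stuffle u v (U ++ [:: Lq j, Lp i & V])
  | stuffle_merge (U V : seq letter) (i j : nat) :
      is_stuffle u v (U ++ [:: Lp i, Lq j & V]) ->
      is_stuffle u v (U ++ Lpq i j :: V).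

Definition stuffle (p q : seq nat) : set (seq letter) :=
  [set w | is_stuffle (size p) (size q) w].

Definition letter_val (p q : seq nat) (c : letter) : nat :=
  match c with
  | Lp i => nth 0 p i
  | Lq j => nth 0 q j
  | Lpq i j => nth 0 p i + nth 0 q j
  end%N.

Definition str_val (p q : seq nat) (w : seq letter) : seq nat :=
  [seq letter_val p q c | c <- w].

(* The sum over f in stuffle(p, q) of zeta(a, f). *)
Definition stuffle_sum (R : realType) (a : nat) (p q : seq nat) : R :=
  \sum_(w \in stuffle p q) mzv R a (str_val p q w).

(* l_1 < ... < l_(h-1), completed by l_h := n - 1.  In particular l_1 = n - 1
   when h = 1. *)
Definition ells (n h : nat) (l : h.-tuple 'I_n.-1) : seq nat :=
  rcons [seq val i | i <- l] n.-1.

(* (l_1, l_2 - l_1, ..., n - 1 - l_(h-1)) *)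
Definition ell1 (n h : nat) (l : h.-tuple 'I_n.-1) : seq nat :=
  pairmap (fun a b => b - a)%N 0%N (ells l).

(* (l_2 - l_1, l_3 - l_2, ..., n - 1 - l_(h-1)) *)
Definition ell2 (n h : nat) (l : h.-tuple 'I_n.-1) : seq nat :=
  pairmap (fun a b => b - a)%N (head 0%N (ells l)) (behead (ells l)).

(* 1 <= l_1 < ... < l_(h-1); the bound l_(h-1) < n - 1 is in the type. *)
Definition increasing_pos (n h : nat) (l : h.-tuple 'I_n.-1) : bool :=
  path ltn 0%N [seq val i | i <- l].

(* Main.v *)
(* Substituting the power series of Li turns xi(n) into a sum over m of
   mhs(k, m) / m ^ k1 times the integral of
   t ^ (n-1) / (n-1)! (1 - e^-t) ^ (m-1) e^-t over t > 0; all terms are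
   nonnegative, so sum and integral commute.  Integrating by parts shows that
   m times this integral satisfies S_p(m) = S_p(m-1) + S_(p-1)(m) / m with
   p = n-1, i.e. it is the sum of 1 / (j_1 ... j_p) over
   m >= j_1 >= ... >= j_p >= 1.  Grouping equal j's gives one strict harmonic
   sum with bound m+1 per composition of n-1; separating the case j_1 = m from
   j_1 < m produces the two sums over l.  Multiplying by mhs(k, m) with the
   stuffle product and summing over m gives the zeta values. *)

Require Import Defs.
From mathcomp Require Import all_boot all_order all_algebra.
From mathcomp Require Import all_classical all_reals all_analysis.
From mathcomp Require Import measurable_realfun ring lra zify.
Set Implicit Arguments.
Unset Strict Implicit.
Unset Printing Implicit Defensive.
Import Order.TTheory GRing.Theory Num.Theory.
Import numFieldNormedType.Exports.
Local Open Scope classical_set_scope.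
Local Open Scope ring_scope.

(** * The stuffle product *)

(** [pproj] and [qproj] will characterize the stuffle set without mention of the order in which
    swaps and merges are performed. *)
Definition pproj (w : seq letter) : seq nat :=
  pmap (fun c => match c with Lp i | Lpq i _ => Some i | Lq _ => None end) w.

Definition qproj (w : seq letter) : seq nat :=
  pmap (fun c => match c with Lq j | Lpq _ j => Some j | Lp _ => None end) w.

Lemma pproj_map_Lp s : pproj [seq Lp i | i <- s] = s.
Proof. by elim: s => //= a s ->. Qed.

Lemma pproj_map_Lq s : pproj [seq Lq i | i <- s] = [::].
Proof. by elim: s. Qed.

Lemma qproj_map_Lp s : qproj [seq Lp i | i <- s] = [::].
Proof. by elim: s. Qed.

Lemma qproj_map_Lq s : qproj [seq Lq i | i <- s] = s.
Proof. by elim: s => //= a s ->. Qed.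

(** A swap or a merge involves one letter of each family, so it never disturbs the order inside
    either family. *)
Lemma is_stuffle_proj u v w : is_stuffle u v w ->
  pproj w = iota 0 u /\ qproj w = iota 0 v.
Proof.
rewrite /pproj /qproj.
elim=> [|U V i j _ IH|U V i j _ IH]; last 2 first.
- by move: IH; rewrite !pmap_cat.
- by move: IH; rewrite !pmap_cat.
rewrite !pmap_cat; split.
- by have := pproj_map_Lp (iota 0 u); have := pproj_map_Lq (iota 0 v);
    rewrite /pproj => -> ->; rewrite cats0.
- by have := qproj_map_Lp (iota 0 u); have := qproj_map_Lq (iota 0 v);
    rewrite /qproj => -> ->.
Qed.

Lemma is_stuffle_move u v U s j V :
  is_stuffle u v (U ++ [seq Lp i | i <- s] ++ Lq j :: V) ->
  is_stuffle u v (U ++ Lq j :: [seq Lp i | i <- s] ++ V).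
Proof.
elim: s U => //= i s IH U; rewrite -cat_rcons => /IH.
by rewrite cat_rcons => /stuffle_swap.
Qed.

(* Swaps and merges turn the sorted letters of [w] back into [w], from left to
   right; [U] is the part already rebuilt. *)
Lemma is_stuffle_unsort u v U w :
  is_stuffle u v
    (U ++ [seq Lp i | i <- pproj w] ++ [seq Lq j | j <- qproj w]) ->
  is_stuffle u v (U ++ w).
Proof.
elim: w U => //= -[i|j|i j] w IH U /=.
- by rewrite -!cat_rcons; apply: IH.
- by move=> /is_stuffle_move; rewrite -!(cat_rcons (Lq j)); apply: IH.
- rewrite -cat_rcons => /is_stuffle_move.
  by rewrite cat_rcons => /stuffle_merge; rewrite -!(cat_rcons (Lpq i j));
    apply: IH.
Qed.

Lemma is_stuffleE u v w :
  is_stuffle u v w <-> pproj w = iota 0 u /\ qproj w = iota 0 v.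
Proof.
split; first exact: is_stuffle_proj.
move=> [pw qw]; rewrite -[w]cat0s; apply: is_stuffle_unsort.
by rewrite pw qw; exact: stuffle_cat.
Qed.

(** The quasi-shuffle recursion on the first letter. It runs over lists of positions, since tails of
    [iota 0 u] are no longer of that form; the inner [fix] serves the branch where only [t]
    shrinks. *)
Fixpoint stuffle_seq (s : seq nat) : seq nat -> seq (seq letter) :=
  match s with
  | [::] => fun t => [:: [seq Lq j | j <- t]]
  | i :: s' => fix aux (t : seq nat) :=
      match t with
      | [::] => [:: [seq Lp i | i <- s]]
      | j :: t' => [seq Lp i :: w | w <- stuffle_seq s' t]
                   ++ [seq Lq j :: w | w <- aux t']
                   ++ [seq Lpq i j :: w | w <- stuffle_seq s' t']
      end
  end.

Lemma stuffle_seq0s t : stuffle_seq [::] t = [:: [seq Lq j | j <- t]].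
Proof. by []. Qed.

Lemma stuffle_seqs0 s : stuffle_seq s [::] = [:: [seq Lp i | i <- s]].
Proof. by case: s. Qed.

Lemma stuffle_seq_cons i s j t :
  stuffle_seq (i :: s) (j :: t) =
    [seq Lp i :: w | w <- stuffle_seq s (j :: t)]
    ++ [seq Lq j :: w | w <- stuffle_seq (i :: s) t]
    ++ [seq Lpq i j :: w | w <- stuffle_seq s t].
Proof. by []. Qed.

Arguments stuffle_seq : simpl never.

Lemma mem_map_cons (T : eqType) (x y : T) (w : seq T) (L : seq (seq T)) :
  (y :: w \in [seq x :: z | z <- L]) = (y == x) && (w \in L).
Proof.
apply/mapP/andP => [[z zL [-> ->]]|[/eqP -> wL]]; first by rewrite eqxx.
by exists w.
Qed.

(** The first letter of [w] selects the branch of the recursion and is removed from the matching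
    projections. With [is_stuffleE] this makes [stuffle_seq] an enumeration of the stuffle set. *)
Lemma mem_stuffle_seq s t w :
  w \in stuffle_seq s t <-> pproj w = s /\ qproj w = t.
Proof.
elim: w s t => [|c w IH] [|i s] [|j t].
- by [].
- by rewrite stuffle_seq0s inE; split=> // -[].
- by rewrite stuffle_seqs0 inE; split=> // -[].
- rewrite stuffle_seq_cons !mem_cat.
  by split=> [/or3P[]/mapP[]//|[]].
- by rewrite stuffle_seq0s inE; split=> // -[]; case: c.
- rewrite stuffle_seq0s inE; split=> [/eqP[-> ->]|].
    by rewrite /= -/(pproj _) -/(qproj _) pproj_map_Lq qproj_map_Lq.
  case: c => [?|j'|? ?] []//=; rewrite -/(pproj _) -/(qproj _) => pw [-> qw].
  by have /IH := conj pw qw; rewrite stuffle_seq0s inE => /eqP ->.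
- rewrite stuffle_seqs0 inE; split=> [/eqP[-> ->]|].
    by rewrite /= -/(pproj _) -/(qproj _) pproj_map_Lp qproj_map_Lp.
  case: c => [j'|?|? ?] []//=; rewrite -/(pproj _) -/(qproj _) => -[-> pw] qw.
  by have /IH := conj pw qw; rewrite stuffle_seqs0 inE => /eqP ->.
- rewrite stuffle_seq_cons !mem_cat !mem_map_cons; split.
  + by case/or3P => /andP[/eqP -> /IH[p q]];
      rewrite /= -/(pproj _) -/(qproj _) p q.
  + case: c => [i'|j'|i' j']; rewrite /= -/(pproj _) -/(qproj _) => -[].
    * by move=> -[-> p] q; rewrite eqxx/=; have /IH -> := conj p q.
    * by move=> p [-> q]; rewrite eqxx/=; have /IH -> := conj p q; rewrite orbT.
    * move=> [-> p] [-> q]; rewrite eqxx/=; have /IH -> := conj p q.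
      by rewrite !orbT.
Qed.

(** The three branches have different first letters, hence are disjoint. *)
Lemma stuffle_seq_uniq s t : uniq (stuffle_seq s t).
Proof.
have consI (c : letter) : injective (cons c) by move=> ? ? [].
elim: s t => [|i s IHs] //; elim=> [|j t IHt] //.
rewrite stuffle_seq_cons !cat_uniq !(map_inj_uniq (consI _)) !IHs IHt /= andbT.
apply/andP; split; apply/hasPn => w.
  by rewrite mem_cat => /orP[] /mapP[x _ ->]; apply/mapP => -[].
by move=> /mapP[x _ ->]; apply/mapP => -[].
Qed.

Lemma stuffle_sumE (R : realType) a p q :
  stuffle_sum R a p q =
    \sum_(w <- stuffle_seq (iota 0 (size p)) (iota 0 (size q)))
      mzv R a (str_val p q w).
Proof.
rewrite /stuffle_sum [RHS]fsbig_seq ?stuffle_seq_uniq//.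
rewrite (_ : stuffle p q =
  [set` stuffle_seq (iota 0 (size p)) (iota 0 (size q))])//.
by apply/seteqP; split=> w /=; rewrite mem_stuffle_seq => /is_stuffleE.
Qed.

(** * Products of truncated harmonic sums *)

Arguments mhs : simpl never.

Lemma mhs_recr (R : realType) a s N : (0 < N)%N ->
  mhs R (a :: s) N.+1 = mhs R (a :: s) N + (N%:R ^+ a)^-1 * mhs R s N.
Proof. by move=> N0; rewrite /mhs big_nat_recr. Qed.

Lemma mhs_cons1 (R : realType) a s : mhs R (a :: s) 1 = 0.
Proof. by rewrite /mhs big_geq. Qed.

Lemma sum_mhs_recr (R : realType) p q c (L : seq (seq letter)) N :
  (0 < N)%N ->
  \sum_(w <- [seq c :: w | w <- L]) mhs R (str_val p q w) N.+1 =
    \sum_(w <- [seq c :: w | w <- L]) mhs R (str_val p q w) N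
    + (N%:R ^+ letter_val p q c)^-1 * \sum_(w <- L) mhs R (str_val p q w) N.
Proof.
move=> N0; rewrite !big_map mulr_sumr -big_split.
by apply: eq_bigr => w _; rewrite /str_val map_cons mhs_recr.
Qed.

(** Induction on both words and on the bound: at bound 1 both sides vanish when the words are
    nonempty, and afterwards only the increments need to agree. *)
Lemma mhs_stuffle_seq (R : realType) p q s t N : (0 < N)%N ->
  mhs R [seq nth 0%N p i | i <- s] N * mhs R [seq nth 0%N q j | j <- t] N =
    \sum_(w <- stuffle_seq s t) mhs R (str_val p q w) N.
Proof.
elim: s t N => [|i s IHs] t N N0.
  by rewrite big_seq1 /= mul1r /str_val -map_comp.
elim: t N N0 => [|j t IHt] N N0.
  by rewrite big_seq1 mulr1 /str_val -map_comp.
elim: N N0 => // -[_ _|N IHN _].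
  rewrite !map_cons !mhs_cons1 mul0r big1_seq//= => w.
  rewrite stuffle_seq_cons !mem_cat /str_val.
  by case/or3P => /mapP[x _ ->]; rewrite map_cons mhs_cons1.
rewrite stuffle_seq_cons in IHN *; move/(_ isT): IHN.
rewrite !big_cat /= => IHN.
(* With A, B the factors at the smaller bound and a, b their increments, (A + a)(B + b) - AB = aB +
   Ab + ab; the three terms are the increments of the words starting with [Lp i], [Lq j] and
   [Lpq i j]. *)
rewrite !(@sum_mhs_recr _ _ _ _ _ N.+1)// -!IHs// -IHt//.
rewrite !map_cons in IHN *; rewrite !(@mhs_recr _ _ _ N.+1)//= exprD invfM.
rewrite mulrDl !mulrDr IHN; ring.
Qed.

Lemma mhsM (R : realType) p q N : (0 < N)%N ->
  mhs R p N * mhs R q N =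
    \sum_(w <- stuffle_seq (iota 0 (size p)) (iota 0 (size q)))
      mhs R (str_val p q w) N.
Proof. by move=> N0; rewrite -mhs_stuffle_seq// -!/(mkseq _ _) !mkseq_nth. Qed.

Lemma str_val_gt0 p q w : all (leq 1) p -> all (leq 1) q ->
  w \in stuffle_seq (iota 0 (size p)) (iota 0 (size q)) ->
  all (leq 1) (str_val p q w).
Proof.
move=> /all_nthP p0 /all_nthP q0 /mem_stuffle_seq[pw qw].
have {pw p0} : all (fun i => 0 < nth 0 p i)%N (pproj w).
  by rewrite pw; apply/allP => i; rewrite mem_iota add0n; apply: p0.
have {qw q0} : all (fun j => 0 < nth 0 q j)%N (qproj w).
  by rewrite qw; apply/allP => j; rewrite mem_iota add0n; apply: q0.
elim: w => //= -[i|j|i j] w IH; rewrite /= -/(pproj _) -/(qproj _).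
- by move=> qw /andP[-> pw]; rewrite IH.
- by move=> /andP[-> qw] pw; rewrite IH.
- by move=> /andP[j0 qw] /andP[i0 pw]; rewrite IH// addn_gt0 i0.
Qed.

(** * Compositions *)

(* These are the compositions of [N.+1], not of [N]. *)
Fixpoint compositions (N : nat) : seq (seq nat) :=
  if N is N'.+1 then
    [seq 1%N :: c | c <- compositions N']
    ++ [seq (head 0%N c).+1 :: behead c | c <- compositions N']
  else [:: [:: 1%N]].

(** Removing a leading 1, or lowering a leading part that is at least 2, inverts the two branches of
    the recursion. *)
Lemma mem_compositions N c :
  (c \in compositions N) = all (leq 1) c && (sumn c == N.+1).
Proof.
elim: N c => [|N IH] c /=.
  by case: c => [//|[|[|a]] [|[|b] c]]; rewrite ?inE//= ?andbF.
rewrite mem_cat; apply/orP/idP.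
  case=> /mapP[d]; rewrite IH => /andP[d0 /eqP dN] ->{c}.
    by rewrite /= d0 dN add1n eqxx.
  by case: d d0 dN => [//|a d] /= /andP[_ ->] <-; rewrite addSn eqxx.
case: c => [//|[//|[|a]] c] /= /andP[c0]; rewrite !addSn eqSS => cN;
  [left|right].
  by apply: map_f; rewrite IH c0.
by apply/mapP; exists (a.+1 :: c) => //; rewrite IH /= c0 addSn.
Qed.

Lemma compositions_uniq N : uniq (compositions N).
Proof.
elim: N => //= N IH; rewrite cat_uniq !map_inj_in_uniq ?IH/= ?andbT//.
- apply/hasPn => x /mapP[c]; rewrite mem_compositions => cN -> {x}.
  by apply/mapP => -[d dN []]; case: c cN => [//|[|a] c].
- move=> c d; rewrite !mem_compositions.
  by case: c d => [|a c] [|b d] //= _ _ [-> ->].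
- by move=> ? ? _ _ [].
Qed.

(** The non-strict harmonic sum over m >= j_1 >= ... >= j_n >= 1 of 1 / (j_1 ... j_n); unlike in
    [mhs], the bound is attained. *)
Fixpoint star_sum (R : realType) (n m : nat) : R :=
  if n is n'.+1 then \sum_(1 <= j < m.+1) j%:R^-1 * star_sum R n' j else 1.

Lemma star_sumS (R : realType) n m :
  star_sum R n.+1 m.+1 = star_sum R n.+1 m + m.+1%:R^-1 * star_sum R n m.+1.
Proof. by rewrite [LHS]/= big_nat_recr. Qed.

Lemma star_sumE (R : realType) n m :
  star_sum R n.+1 m = \sum_(c <- compositions n) mhs R c m.+1.
Proof.
elim: n m => [|n IHn] m.
  by rewrite big_seq1 /mhs /=; apply: eq_bigr => j _; rewrite expr1.
elim: m => [|m IHm].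
  rewrite big1_seq => [|c /andP[_]]; first by rewrite /= big_geq.
  by rewrite mem_compositions; case: c => // a c _; rewrite mhs_cons1.
rewrite star_sumS IHm IHn /= !big_cat !big_map /=.
rewrite mulr_sumr -!big_split /= !big_seq.
apply: eq_bigr => c; rewrite mem_compositions; case: c => [//|a c] _ /=.
(* A further index m+1 is put in front of the sum for [a :: c] with bound m+1: if the old first
   index is smaller, a part 1 is prepended; if it is equal, [a] is raised by one. *)
rewrite !(@mhs_recr _ _ _ m.+1)// expr1 (exprS _ a) invfM; ring.
Qed.

(** * Increasing tuples as partial sums of compositions *)

Lemma path_ltn_last x e : path ltn x e -> (x <= last x e)%N.
Proof.
elim: e x => //= y e IH x /andP[xy /IH]; apply: leq_trans; exact: ltnW.
Qed.

(** Successive differences and partial sums are inverse to each other; [scanl_addn_path] gives the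
    other direction. *)
Lemma pairmap_subn_path x e : path ltn x e ->
  [/\ all (leq 1) (pairmap (fun a b => b - a)%N x e),
      sumn (pairmap (fun a b => b - a)%N x e) = (last x e - x)%N &
      scanl addn x (pairmap (fun a b => b - a)%N x e) = e].
Proof.
elim: e x => [|y e IH] x /=; first by rewrite subnn.
move=> /andP[xy ye]; have [-> -> e3] := IH _ ye.
have yl := path_ltn_last ye.
by split; [rewrite subn_gt0 xy | lia | rewrite subnKC ?e3// ltnW].
Qed.

Lemma scanl_addn_path x c : all (leq 1) c ->
  [/\ path ltn x (scanl addn x c), last x (scanl addn x c) = (x + sumn c)%N &
      pairmap (fun a b => b - a)%N x (scanl addn x c) = c].
Proof.
elim: c x => [|y c IH] x /=; first by rewrite addn0.
move=> /andP[y0 /(IH (x + y)%N)[-> -> ->]].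
by split; [rewrite -[X in (X < _)%N]addn0 ltn_add2l y0 | rewrite addnA |
  rewrite addKn].
Qed.

Lemma path_ltn_rcons x e M : path ltn x (rcons e M) -> all (fun i => i < M)%N e.
Proof.
elim: e x => //= y e IH x /andP[_ eM]; rewrite (IH _ eM) andbT.
by move: eM; rewrite rcons_path => /andP[/path_ltn_last + ];
  apply: leq_ltn_trans.
Qed.

Lemma ells_path n h (l : h.-tuple 'I_n.+1) :
  increasing_pos (n := n.+2) l -> path ltn 0%N (ells (n := n.+2) l).
Proof.
rewrite /increasing_pos /ells rcons_path => -> /=.
case: (lastP (tval l)) => // s i.
by rewrite map_rcons last_rcons; case: i.
Qed.

Lemma perm_ell1_compositions n h : (0 < h)%N ->
  perm_eq [seq ell1 (n := n.+2) l |
            l <- enum [pred l : h.-1.-tuple 'I_n.+1 |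
                        increasing_pos (n := n.+2) l]]
          [seq c <- compositions n | size c == h].
Proof.
case: h => // h _ /=; apply: uniq_perm.
- rewrite map_inj_in_uniq ?enum_uniq// => l1 l2.
  rewrite !mem_enum !inE => /ells_path/pairmap_subn_path[_ _ e1].
  move=> /ells_path/pairmap_subn_path[_ _ e2] e12; apply/val_inj.
  move: e1 e2; rewrite -!/(ell1 _) e12 => -> /rcons_inj[/inj_map]; apply.
  exact: val_inj.
- by rewrite filter_uniq ?compositions_uniq.
move=> c; rewrite mem_filter mem_compositions; apply/mapP/and3P.
  move=> [l]; rewrite mem_enum inE => /ells_path/pairmap_subn_path[c0 cs _] ->.
  rewrite size_pairmap /ells size_rcons size_map size_tuple; split=> //.
  by rewrite cs last_rcons subn0.
move=> [/eqP sc c0 /eqP cn].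
have [pe le ec] := scanl_addn_path 0 c0.
have se := size_scanl addn 0%N c; move: pe le ec se; rewrite sc add0n cn.
(* The last partial sum is the total n+1, which is the endpoint appended by [ells]; the remaining
   ones form the tuple. *)
case: (lastP (scanl addn 0%N c)) => // e M pe; rewrite last_rcons => eM.
rewrite {M}eM in pe *.
rewrite size_rcons => ec [se].
have en := path_ltn_rcons pe.
(* By [en] all entries are below n+1, so [inord] does not change their values. *)
have sl : size [seq inord i : 'I_n.+1 | i <- e] == h by rewrite size_map se.
have vl : [seq val i | i <- [seq inord i : 'I_n.+1 | i <- e]] = e.
  rewrite -map_comp -[RHS]map_id; apply/eq_in_map => i /(allP en) iN /=.
  by rewrite inordK.
exists (Tuple sl).
  rewrite mem_enum inE /increasing_pos /= vl.
  by move: pe; rewrite rcons_path => /andP[].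
by rewrite /ell1 /ells /= vl ec.
Qed.

Lemma sum_tuples_compositions (V : nmodType) n (F : seq nat -> V) :
  \sum_(1 <= h < n.+2)
     \sum_(l : h.-1.-tuple 'I_n.+1 | increasing_pos (n := n.+2) l)
       F (ell1 (n := n.+2) l)
  = \sum_(c <- compositions n) F c.
Proof.
transitivity
  (\sum_(1 <= h < n.+2) \sum_(c <- compositions n | size c == h) F c).
  rewrite !big_nat; apply: eq_bigr => h /andP[h0 _].
  rewrite -[RHS]big_filter -(perm_big _ (perm_ell1_compositions n h0)).
  by rewrite big_map big_enum.
rewrite (exchange_big_dep xpredT)//= big_seq [RHS]big_seq.
apply: eq_bigr => c; rewrite mem_compositions => /andP[c0 /eqP cn].
(* Positive parts with total n+1 number at most n+1, so the range of [h] misses no composition. *)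
have cN : (size c < n.+2)%N.
  rewrite ltnS -cn; elim: c c0 {cn} => //= a c IH /andP[a0 /IH cs].
  by rewrite -add1n leq_add.
have c1 : (0 < size c)%N by case: c cn {c0 cN}.
rewrite (eq_bigl (fun h => h == size c)); last by move=> h; rewrite eq_sym.
by rewrite big_nat1_eq c1 cN.
Qed.

(** * Convergence *)

Lemma mhs_ge0 (R : realType) a N : 0 <= mhs R a N.
Proof.
elim: a N => [|a s IH] N; first by rewrite ler01.
by rewrite /mhs sumr_ge0// => m _; rewrite mulr_ge0 ?invr_ge0 ?exprn_ge0.
Qed.

(* Grows like the square root of [N]: this is the rational substitute for
   [N ^ (1/2)] for which the sums below telescope. *)
Definition half_power (R : realType) (N : nat) : R :=
  \prod_(1 <= i < N) (1 + (2 * i%:R)^-1).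

Lemma half_powerS (R : realType) N : (0 < N)%N ->
  half_power R N.+1 = half_power R N * (1 + (2 * N%:R)^-1).
Proof. by move=> N0; rewrite /half_power big_nat_recr. Qed.

Lemma half_power_ge1 (R : realType) N : 1 <= half_power R N.
Proof.
by rewrite /half_power; elim/big_ind: _ => // [x y|i _];
  [exact: mulr_ege1 | rewrite lerDl invr_ge0 mulr_ge0].
Qed.

Lemma half_power_le (R : realType) N : (0 < N)%N -> half_power R N <= N%:R.
Proof.
elim: N => // -[_ _|N IH _]; first by rewrite /half_power big_geq.
have N0 : 0 < N.+1%:R :> R by [].
rewrite half_powerS// (@le_trans _ _ (N.+1%:R * (1 + (2 * N.+1%:R)^-1)))//.
  by rewrite ler_wpM2r ?IH// addr_ge0 ?invr_ge0 ?mulr_ge0.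
rewrite mulrDr mulr1 -[N.+2]addn1 natrD lerD2l invfM mulrCA divff ?gt_eqF//.
by rewrite mulr1 invf_le1// ler1n.
Qed.

Lemma invX_le (R : realType) a b N : (a <= b)%N -> (0 < N)%N ->
  (N%:R ^+ b)^-1 <= (N%:R ^+ a)^-1 :> R.
Proof.
move=> ab N0; rewrite lef_pV2 ?posrE ?exprn_gt0 ?ltr0n//.
by rewrite ler_weXn2l// ler1n.
Qed.

(** Since [half_power] grows by h(N) / (2 N) from N to N+1, the sum of h(m) / m telescopes to at
    most 2 h(N): each exponent costs a factor 2. *)
Lemma mhs_le (R : realType) a N : all (leq 1) a -> (0 < N)%N ->
  mhs R a N <= 2 ^+ size a * half_power R N.
Proof.
elim: a N => [|a s IH] N /=; first by rewrite mul1r half_power_ge1.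
move=> /andP[a0 s0]; elim: N => // -[_ _|N IHN _].
  by rewrite mhs_cons1 mulr_ge0 ?exprn_ge0// (le_trans _ (half_power_ge1 R 1)).
rewrite mhs_recr// half_powerS// mulrA mulrDr mulr1 lerD ?IHN//.
apply: (le_trans (ler_pM _ _ (invX_le R a0 (ltn0Sn N)) (IH _ s0 (ltn0Sn N)))).
- by rewrite invr_ge0 exprn_ge0.
- exact: mhs_ge0.
by rewrite expr1 exprS invfM le_eqVlt; apply/orP; left; apply/eqP; field.
Qed.

(** Here the telescoping quantity is h(N) / N, which drops by h(N) / (2 N (N+1)); four times this
    drop dominates h(N) / N ^ 2, whence the two extra factors 2. *)
Lemma mhs_le_conv (R : realType) a s N : (2 <= a)%N -> all (leq 1) s ->
  (0 < N)%N ->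
  mhs R (a :: s) N <= 2 ^+ (size s).+2 * (1 - half_power R N / N%:R).
Proof.
move=> a2 s0; elim: N => // -[_ _|N IHN _].
  by rewrite mhs_cons1 /half_power big_geq// divr1 subrr mulr0.
rewrite mhs_recr// half_powerS//.
apply: (le_trans (lerD (IHN isT)
  (ler_pM _ _ (invX_le R a2 (ltn0Sn N)) (mhs_le R s0 (ltn0Sn N))))).
- by rewrite invr_ge0 exprn_ge0.
- exact: mhs_ge0.
set h := half_power R N.+1.
have h0 : 0 <= h by rewrite (le_trans _ (half_power_ge1 R _)).
set c : R := 2 ^+ size s; have c0 : 0 <= c by rewrite exprn_ge0.
rewrite !exprS -/c -subr_ge0 -[N.+2]addn1 natrD.
set x : R := N.+1%:R; have x1 : 1 <= x by rewrite ler1n.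
rewrite [leRHS](_ : _ = c * h * (x - 1) / (x ^+ 2 * (x + 1))); last first.
  by field; rewrite !gt_eqF//; lra.
by rewrite divr_ge0 ?mulr_ge0 ?subr_ge0 ?exprn_ge0//; lra.
Qed.

Lemma mzvE (R : realType) a s : mzv R a s = limn (mhs R (a :: s)).
Proof. by []. Qed.

Lemma mhs_nondecreasing (R : realType) a s :
  nondecreasing_seq (mhs R (a :: s)).
Proof.
apply/nondecreasing_seqP => -[|N].
  by rewrite /mhs !big_geq.
by rewrite [leRHS]mhs_recr// lerDl mulr_ge0 ?mhs_ge0 ?invr_ge0 ?exprn_ge0.
Qed.

Lemma mhs_cvg (R : realType) a s : (2 <= a)%N -> all (leq 1) s ->
  mhs R (a :: s) @ \oo --> mzv R a s.
Proof.
move=> a2 s0; rewrite mzvE.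
apply: nondecreasing_is_cvgn; first exact: mhs_nondecreasing.
exists (2 ^+ (size s).+2) => _ [N _ <-].
rewrite (le_trans (mhs_nondecreasing R a s (leqnSn N)))//.
rewrite (le_trans (mhs_le_conv R a2 s0 (ltn0Sn N)))//.
rewrite ler_piMr ?exprn_ge0// gerBl divr_ge0//.
by rewrite (le_trans _ (half_power_ge1 R _)).
Qed.

(** By [mhs_le] and [half_power_le] the coefficient of z ^ m is at most 2 ^ [size k], so a geometric
    series dominates. *)
Lemma Li_cvg (R : realType) k1 k (z : R) : (1 <= k1)%N -> all (leq 1) k ->
  0 <= z < 1 ->
  cvgn (fun N : nat => \sum_(1 <= m < N) z ^+ m / m%:R ^+ k1 * mhs R k m).
Proof.
move=> k10 k0 /andP[z0 z1]; apply: nondecreasing_is_cvgn.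
  apply/nondecreasing_seqP => -[|N]; first by rewrite !big_geq.
  rewrite [leRHS]big_nat_recr//= lerDl.
  by rewrite mulr_ge0 ?mhs_ge0 ?divr_ge0 ?exprn_ge0.
exists (2 ^+ size k * (1 - z)^-1) => _ [N _ <-].
apply: (@le_trans _ _ (2 ^+ size k * \sum_(0 <= m < N) z ^+ m)); last first.
  rewrite ler_wpM2l ?exprn_ge0// -[_^-1]mul1r ler_pdivlMr ?subr_gt0//.
  rewrite mulrC; have := subrX1 z N; rewrite big_mkord => zN.
  have : (1 - z) * (\sum_(i < N) z ^+ i) = 1 - z ^+ N.
    by rewrite -opprB mulNr -zN opprB.
  by move=> ->; rewrite gerBl exprn_ge0.
case: N => [|N]; first by rewrite !big_geq// mulr0.
rewrite [in leRHS]big_nat_recl//=.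
rewrite -(big_add1 _ _ 0 N.+1 xpredT (fun m => z ^+ m)).
rewrite mulrDr ler_wpDl ?mulr_ge0 ?exprn_ge0// mulr_sumr.
rewrite !big_nat ler_sum// => m /andP[m0 _].
rewrite -mulrA [leRHS]mulrC ler_wpM2l ?exprn_ge0//.
apply: (le_trans (ler_pM _ _ (invX_le R k10 m0) (mhs_le R k0 m0))).
- by rewrite invr_ge0 exprn_ge0.
- exact: mhs_ge0.
rewrite expr1 mulrC -mulrA ler_piMr ?exprn_ge0// ler_pdivrMr ?ltr0n// mul1r.
exact: half_power_le.
Qed.

(** * The integrals of t ^ n / n! (1 - e^-t) ^ m e^-t *)

Definition gamma_kernel (R : realType) (n m : nat) (t : R) : R :=
  t ^+ n / n`!%:R * ((1 - expR (- t)) ^+ m * expR (- t)).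

Lemma is_derive_expRN (R : realType) (t : R) :
  is_derive t 1 (fun u => expR (- u)) (- expR (- t)).
Proof.
have d := is_derive1_comp (is_derive_expR (- t)) (is_deriveNid t 1).
by apply: (is_derive_eq d); rewrite mulrN1.
Qed.

(** At m = 0 the factor [m%:R] vanishes, so the truncated [m.-1] is harmless. *)
Lemma is_derive_1expX (R : realType) m (t : R) :
  is_derive t 1 (fun u => (1 - expR (- u)) ^+ m)
    (m%:R * ((1 - expR (- t)) ^+ m.-1 * expR (- t))).
Proof.
have dB : is_derive t 1 (fun u : R => 1 - expR (- u)) (expR (- t)).
  have d := is_deriveB (is_derive_cst (1 : R) t 1) (is_derive_expRN t).
  by apply: (is_derive_eq d); rewrite sub0r opprK.
have := is_deriveX m dB; rewrite exprfctE => d; apply: (is_derive_eq d).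
by rewrite /GRing.scale /= mulrA.
Qed.

(** The product rule, with one factor e^-t rewritten as 1 - (1 - e^-t). This relation carries the
    integration by parts. *)
Lemma is_derive_gamma_kernel (R : realType) n m (t : R) :
  is_derive t 1 (gamma_kernel n.+1 m)
    (gamma_kernel n m t
     + (m%:R * gamma_kernel n.+1 m.-1 t - m.+1%:R * gamma_kernel n.+1 m t)).
Proof.
have dX : is_derive t 1 (fun u : R => u ^+ n.+1 / n.+1`!%:R) (t ^+ n / n`!%:R).
  have := is_deriveM (is_deriveX n.+1 (is_derive_id t 1))
    (is_derive_cst (n.+1`!%:R^-1 : R) t 1).
  rewrite exprfctE => d; apply: (is_derive_eq d).
  rewrite scaler0 add0r /= factS natrM /GRing.scale /= mulr1.
  by field; rewrite nat1r !pnatr_eq0 -!lt0n fact_gt0.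
have d :=
  is_deriveM dX (is_deriveM (is_derive_1expX m t) (is_derive_expRN t)).
apply: (is_derive_eq d); rewrite /gamma_kernel /GRing.scale !fctE /=.
case: m {d} => [|m] /=; first by ring.
rewrite (exprS _ m); ring.
Qed.

Lemma gamma_kernel_ge0 (R : realType) n m (t : R) : 0 <= t ->
  0 <= gamma_kernel n m t.
Proof.
move=> t0; rewrite /gamma_kernel.
rewrite mulr_ge0 ?divr_ge0 ?exprn_ge0 ?mulr_ge0 ?expR_ge0//.
by rewrite exprn_ge0// subr_ge0 expR_le1 oppr_le0.
Qed.

Lemma gamma_kernel_cvg0 (R : realType) n m :
  gamma_kernel n m (t : R) @[t --> +oo] --> 0.
Proof.
apply: (@squeeze_cvgr _ _ _ _ (cst 0) (fun t => n.+1%:R * t^-1)).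
- near=> t.
  have t0 : 0 < t by near: t; apply: nbhs_pinfty_gt; exact: num_real.
  apply/andP; split; first by apply: gamma_kernel_ge0; exact: ltW.
  rewrite /gamma_kernel.
  have e1 : expR (- t) <= 1 by rewrite expR_le1 oppr_le0 ltW.
  rewrite (@le_trans _ _ (t ^+ n / n`!%:R * expR (- t)))//.
    rewrite ler_wpM2l ?divr_ge0 ?exprn_ge0 ?(ltW t0)// ler_piMl ?expR_ge0//.
    by rewrite exprn_ile1 ?subr_ge0// gerBl expR_ge0.
  rewrite expRN ler_pdivrMr ?expR_gt0//.
  (* The majorant (n+1) / t comes from e^t >= t^(n+1) / (n+1)!. *)
  rewrite (@le_trans _ _ (n.+1%:R * t^-1 * (t ^+ n.+1 / n.+1`!%:R)))//.
    rewrite factS natrM exprS le_eqVlt; apply/orP; left; apply/eqP; field.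
    by rewrite (gt_eqF t0) nat1r !pnatr_eq0 -!lt0n fact_gt0.
  rewrite ler_wpM2l ?mulr_ge0 ?invr_ge0 ?(ltW t0)//.
  by rewrite (le_trans _ (expR_ge1Dxn n (ltW t0)))// lerDr.
- exact: cvg_cst.
- rewrite -[X in _ --> X](mulr0 n.+1%:R); apply: cvgMl_tmp.
  apply/gtr0_cvgV0; last exact: cvg_id.
  by near=> t; near: t; apply: nbhs_pinfty_gt; exact: num_real.
Unshelve. all: end_near. Qed.

Lemma expRN_cvg0 (R : realType) m :
  (1 - expR (- t)) ^+ m @[t --> (+oo : set_system R)] --> (1 : R).
Proof.
rewrite -[X in _ --> X](expr1n _ m).
have c1 : (1 - expR (- t)) @[t --> (+oo : set_system R)] --> (1 : R).
  rewrite -[X in _ --> X]subr0.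
  by apply: cvgB; [exact: cvg_cst|exact: cvgr_expR].
exact: (continuous_cvg _ (@exprn_continuous R m 1) c1).
Qed.

(** Explicit primitives replace integration by parts on an unbounded interval; their limits obey the
    recurrence [star_sumS]. *)
Lemma gamma_kernel_primitive (R : realType) n m : exists F : R -> R,
  [/\ F 0 = 0,
      forall t : R, is_derive t 1 F (m.+1%:R * gamma_kernel n m t) &
      F t @[t --> +oo] --> star_sum R n m.+1].
Proof.
elim: n m => [|n IHn] m.
  exists (fun t => (1 - expR (- t)) ^+ m.+1); split.
  - by rewrite oppr0 expR0 subrr expr0n.
  - move=> t; apply: (is_derive_eq (is_derive_1expX m.+1 t)).
    by rewrite /gamma_kernel expr0 divr1 mul1r.
  - exact: expRN_cvg0.
have k0 j : gamma_kernel n.+1 j (0 : R) = 0.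
  by rewrite /gamma_kernel expr0n mul0r mul0r.
elim: m => [|m [G [G0 dG cG]]].
  have [F [F0 dF cF]] := IHn 0.
  exists (F - gamma_kernel n.+1 0); split.
  - by rewrite !fctE F0 k0 subr0.
  - move=> t.
    apply: (is_derive_eq (is_deriveB (dF t) (is_derive_gamma_kernel n 0 t))).
    ring.
  - rewrite star_sumS (_ : star_sum _ _ 0 = 0); last by rewrite /= big_geq.
    rewrite add0r invr1 mul1r -[X in _ --> X]subr0.
    by apply: cvgB => //; exact: gamma_kernel_cvg0.
have [F [F0 dF cF]] := IHn m.+1.
(* Subtracting the kernel cancels the contributions of [G] and [F] and leaves (m+2) times the kernel
   itself; the kernel vanishes at 0 and at infinity, so it does not affect the boundary values. *)
exists (G + m.+2%:R^-1 *: F - gamma_kernel n.+1 m.+1); split.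
- by rewrite !fctE F0 G0 k0 scaler0 addr0 subr0.
- move=> t.
  apply: (is_derive_eq (is_deriveB (is_deriveD (dG t) (is_deriveZ _ (dF t)))
    (is_derive_gamma_kernel n m.+1 t))).
  by rewrite /GRing.scale /=; field.
- rewrite star_sumS -[X in _ --> X]subr0.
  apply: cvgB; last exact: gamma_kernel_cvg0.
  by apply: cvgD => //; exact: cvgMl_tmp.
Qed.

Lemma gamma_kernel_continuous (R : realType) n m :
  continuous (@gamma_kernel R n m).
Proof.
move=> t; apply: cvgM.
  by apply: cvgM; [exact: exprn_continuous|exact: cvg_cst].
have ce : expR (- u) @[u --> t] --> expR (- t).
  by apply: continuous_comp; [exact: opp_continuous|exact: continuous_expR].
apply: cvgM => //; apply: (continuous_cvg _ (@exprn_continuous R m _)).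
by apply: cvgB => //; exact: cvg_cst.
Qed.

Lemma gamma_kernel_measurable (R : realType) n m (D : set R) :
  measurable_fun D (@gamma_kernel R n m).
Proof.
apply: measurable_funS (@measurableT _ _) (@subsetT _ _) _.
apply: continuous_measurable_fun; exact: gamma_kernel_continuous.
Qed.

Lemma integral_gamma_kernel (R : realType) n m :
  (\int[@lebesgue_measure R]_(t in `]0%R, +oo[) (gamma_kernel n m t)%:E
   = (star_sum R n m.+1 / m.+1%:R)%:E)%E.
Proof.
have [F [F0 dF cF]] := gamma_kernel_primitive R n m.
rewrite integral_itv_obnd_cbnd; last first.
  by apply/measurable_EFinP; exact: gamma_kernel_measurable.
have dG (t : R) : is_derive t 1 (m.+1%:R^-1 *: F) (gamma_kernel n m t).
  by apply: (is_derive_eq (is_deriveZ _ (dF t))); rewrite /GRing.scale /= mulKf.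
rewrite (@ge0_continuous_FTC2y _ _ (m.+1%:R^-1 *: F) _
  (star_sum R n m.+1 / m.+1%:R)).
- by rewrite !fctE F0 scaler0 sube0.
- by move=> t; exact: gamma_kernel_ge0.
- by apply: continuous_subspaceT => t; exact: gamma_kernel_continuous.
- by rewrite mulrC; exact: cvgMl_tmp.
- by move=> t _; exact: ex_derive.
- apply: cvg_at_right_filter; apply/differentiable_continuous/derivable1_diffP.
  exact: ex_derive.
- by move=> t _; rewrite derive1E derive_val.
Qed.

(** * The value of [xi] at an integer *)

Lemma integral_gamma_kernelZ (R : realType) n m (c : R) : 0 <= c ->
  (\int[@lebesgue_measure R]_(t in `]0%R, +oo[) (c * gamma_kernel n m t)%:E
   = (c * (star_sum R n m.+1 / m.+1%:R))%:E)%E.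
Proof.
move=> c0; rewrite EFinM -integral_gamma_kernel -ge0_integralZl_EFin//.
- move=> t /=; rewrite in_itv/= andbT => /ltW t0.
  by rewrite lee_fin gamma_kernel_ge0.
- by apply/measurable_EFinP; exact: gamma_kernel_measurable.
Qed.

(** The integrand is p! times the kernel with m = 0, whose integral is [star_sum R p 1] = 1. *)
Lemma Gamma_natS (R : realType) p : Gamma (p.+1%:R : R) = p`!%:R.
Proof.
have s1 : star_sum R p 1 = 1.
  by elim: p => [//|p IH]; rewrite star_sumS IH /= big_geq// add0r invr1 mulr1.
rewrite -[RHS]mulr1 -[X in _ * X]divr1 -[X in _ * (X / _)]s1.
have /(congr1 fine)/= <- := integral_gamma_kernelZ p 0 (ler0n R p`!).
congr fine; apply: eq_integral => t; rewrite inE/= in_itv/= andbT => t0.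
rewrite /gamma_kernel expr0 mul1r -natr1 addrK powR_mulrn ?ltW//.
by congr _%:E; field; rewrite pnatr_eq0 -lt0n fact_gt0.
Qed.

Lemma nneseries_EFin (R : realType) (f : nat -> R) (l : R) :
  \sum_(0 <= m < N) f m @[N --> \oo] --> l -> (\sum_(m <oo) (f m)%:E = l%:E)%E.
Proof.
move=> fl; apply/cvg_lim => //.
under eq_fun do rewrite sumEFin.
by apply: cvg_EFin; [exact: nearW|exact: fl].
Qed.

Lemma mhs_shift (R : realType) a s N :
  mhs R (a :: s) N.+1 = \sum_(0 <= m < N) (m.+1%:R ^+ a)^-1 * mhs R s m.+1.
Proof. by rewrite /mhs big_add1. Qed.

(** Since 1 / (e^t - 1) = e^-t / (1 - e^-t), one power of 1 - e^-t cancels: the term of [Li] with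
    n_1 = m+1 meets the kernel with exponent m. *)
Lemma series_gamma_kernel (R : realType) k1 k p (t : R) :
  (1 <= k1)%N -> all (leq 1) k -> 0 < t ->
  (\sum_(m <oo) (p`!%:R * ((m.+1%:R ^+ k1)^-1 * mhs R k m.+1)
                  * gamma_kernel p m t)%:E
   = (t ^+ p / (expR t - 1) * Li k1 k (1 - expR (- t)))%:E)%E.
Proof.
move=> k10 k0 t0; apply: nneseries_EFin.
have z01 : 0 <= 1 - expR (- t) < 1.
  by rewrite subr_ge0 expR_le1 oppr_le0 ltW//= gtrBl expR_gt0.
have E1 : expR t - 1 != 0 by rewrite gt_eqF// subr_gt0 expR_gt1.
have P0 : p`!%:R != 0 :> R by rewrite pnatr_eq0 -lt0n fact_gt0.
set a := t ^+ p / _.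
have : (fun N => \sum_(1 <= m < N)
  (1 - expR (- t)) ^+ m / m%:R ^+ k1 * mhs R k m) @ \oo -->
    Li k1 k (1 - expR (- t)) := Li_cvg k10 k0 z01.
rewrite -cvg_shiftS => /(@cvgMl_tmp _ _ _ _ _ a); apply: cvg_trans.
apply: near_eq_cvg; apply: nearW => N /=;
rewrite big_add1 /= mulr_sumr; apply: eq_bigr => m _.
rewrite /a /gamma_kernel expRN exprS.
have E0 : expR t != 0 by rewrite gt_eqF ?expR_gt0.
have M0 : m.+1%:R ^+ k1 != 0 :> R by rewrite expf_neq0// pnatr_eq0.
rewrite (_ : 1 - (expR t)^-1 = (expR t - 1) / expR t); last by field.
by field; rewrite E0 P0 M0 E1.
Qed.

Lemma xi_natE (R : realType) k1 k p (l : R) :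
  (1 <= k1)%N -> all (leq 1) k ->
  \sum_(0 <= m < N) (m.+1%:R ^+ k1.+1)^-1 * mhs R k m.+1 * star_sum R p m.+1
    @[N --> \oo] --> l ->
  xi k1 k (p.+1%:R : R) = l.
Proof.
move=> k10 k0 cl; rewrite /xi Gamma_natS.
have P0 : p`!%:R != 0 :> R by rewrite pnatr_eq0 -lt0n fact_gt0.
have c0 m : 0 <= p`!%:R * ((m.+1%:R ^+ k1)^-1 * mhs R k m.+1).
  by rewrite !mulr_ge0 ?mhs_ge0 ?invr_ge0 ?exprn_ge0.
suff : (\int[@lebesgue_measure R]_(t in `]0%R, +oo[)
    (t `^ (p.+1%:R - 1) / (expR t - 1) * Li k1 k (1 - expR (- t)))%:E
    = (p`!%:R * l)%:E)%E.
  by move=> /(congr1 fine)/= E; rewrite /Rintegral E mulKf.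
transitivity (\int[@lebesgue_measure R]_(t in `]0%R, +oo[)
    (\sum_(m <oo) (p`!%:R * ((m.+1%:R ^+ k1)^-1 * mhs R k m.+1)
                  * gamma_kernel p m t)%:E))%E.
  apply: eq_integral => t; rewrite inE/= in_itv/= andbT => t0.
  by rewrite series_gamma_kernel// -natr1 addrK powR_mulrn// ltW.
(* Nonnegative terms allow integration term by term. Each integral brings a factor 1 / (m+1), which
   raises the exponent [k1] to [k1.+1]. *)
rewrite integral_nneseries//; last 2 first.
- move=> m; apply/measurable_EFinP.
  by apply: measurable_funM => //; exact: gamma_kernel_measurable.
- move=> m t /=; rewrite in_itv/= andbT => /ltW t0.
  by rewrite lee_fin mulr_ge0 ?gamma_kernel_ge0.
under eq_eseriesr do rewrite integral_gamma_kernelZ//.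
apply:  nneseries_EFin.
apply: cvg_trans (@cvgMl_tmp _ _ _ _ _ p`!%:R _ cl).
apply: near_eq_cvg; apply: nearW => N /=.
rewrite mulr_sumr; apply: eq_bigr => m _.
by rewrite exprS invfM; ring.
Qed.

(** * Stuffled partial sums and their limits *)

Lemma partial_sum_stuffle (R : realType) k1 k n N :
  \sum_(0 <= m < N) (m.+1%:R ^+ k1.+1)^-1 * mhs R k m.+1 * star_sum R n.+1 m.+1
  = \sum_(c <- compositions n)
      (\sum_(w <- stuffle_seq (iota 0 (size c)) (iota 0 (size k)))
         mhs R ((k1 + 1)%N :: str_val c k w) N.+1
       + \sum_(w <- stuffle_seq (iota 0 (size (behead c))) (iota 0 (size k)))
         mhs R ((k1 + 1 + head 0 c)%N :: str_val (behead c) k w) N.+1).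
Proof.
rewrite !addn1.
under eq_bigr do rewrite star_sumE mulr_sumr.
rewrite exchange_big /= big_seq [RHS]big_seq; apply: eq_bigr => c.
rewrite mem_compositions; case: c => [//|a c] _ /=.
under [in RHS]eq_bigr do rewrite mhs_shift.
under [X in _ = _ + X]eq_bigr do rewrite mhs_shift.
rewrite !(exchange_big _ (stuffle_seq _ _)) /= -big_split /=.
apply: eq_bigr => m _.
(* With n_1 = m+1, [mhs_recr] separates j_1 < n_1 from j_1 = n_1; in the second case the part [a] is
   absorbed into the exponent of n_1. *)
rewrite mhs_recr// -!mulr_sumr -(mhsM R (a :: c))// -mhsM// exprD invfM; ring.
Qed.

Lemma cvg_sum_seq (R : realType) (I : eqType) (s : seq I) (f : I -> nat -> R)
    (l : I -> R) :
  {in s, forall i, f i N @[N --> \oo] --> l i} ->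
  \sum_(i <- s) f i N @[N --> \oo] --> \sum_(i <- s) l i.
Proof.
move=> fl; under eq_cvg do rewrite big_seq.
by rewrite big_seq; apply: cvg_big => //; exact: add_continuous.
Qed.

Lemma cvg_stuffle_sum (R : realType) a p q :
  (2 <= a)%N -> all (leq 1) p -> all (leq 1) q ->
  \sum_(w <- stuffle_seq (iota 0 (size p)) (iota 0 (size q)))
    mhs R (a :: str_val p q w) N.+1 @[N --> \oo] --> stuffle_sum R a p q.
Proof.
move=> a2 p0 q0; rewrite stuffle_sumE.
apply: (@cvg_sum_seq R _ _ (fun w N => mhs R (a :: str_val p q w) N.+1)).
move=> w ws; have := mhs_cvg (R := R) a2 (str_val_gt0 p0 q0 ws).
by rewrite -cvg_shiftS.
Qed.

Theorem corollary1 (R : realType) (k1 : nat) (k : seq nat) (n : nat)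
    (hk1 : (1 <= k1)%N) (hk : all (fun j => 1 <= j)%N k) (hn : (2 <= n)%N) :
  xi k1 k (n%:R : R) =
    \sum_(1 <= h < n)
      \sum_(l : (h.-1).-tuple 'I_n.-1 | increasing_pos l)
        stuffle_sum R (k1 + 1) (ell1 l) k
    + \sum_(1 <= h < n)
        \sum_(l : (h.-1).-tuple 'I_n.-1 | increasing_pos l)
          stuffle_sum R (k1 + 1 + head 0%N (ells l)) (ell2 l) k.
Proof.
case: n hn => [|[|n]]// _; rewrite -big_split /=.
under eq_bigr do rewrite -big_split /=.
(* Both sums become one sum over compositions: for c = [ell1 l] the head is l_1 and the tail is
   [ell2 l]. *)
pose F c := stuffle_sum R (k1 + 1) c k
  + stuffle_sum R (k1 + 1 + head 0%N c) (behead c) k.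
transitivity (\sum_(c <- compositions n) F c); last first.
  rewrite -sum_tuples_compositions; apply: eq_bigr => h _.
  apply: eq_bigr => l _; rewrite /F /ell1 /ell2.
  case E : (ells (n := n.+2) l) => [|a s] /=; last by rewrite subn0.
  (* [ells] ends with the appended n - 1, so it is never empty. *)
  by move: E; rewrite /ells; case: map.
apply: xi_natE => //; under eq_cvg do rewrite partial_sum_stuffle.
apply: cvg_sum_seq => c; rewrite mem_compositions => /andP[c0 _].
(* Both leading exponents are at least [k1 + 1], hence at least 2, as convergence requires. *)
apply: cvgD; apply: cvg_stuffle_sum => //;
  rewrite ?addn1 ?ltnS ?addSn ?ltn_addr//.
by case: c c0 => //= a c /andP[].
Qed.
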